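(* Let $G$ be a locally finite group acting by isometries on a metric space $X$ and having a dense orbit. Suppose that $X$ admits a mapping $\phi$ into a normed space $E$ such that for some functions $\rho_1,\rho_2\colon\mathbb{R}_+\to\mathbb{R}_+$ one has, for all $x,y\in X$, $$\rho_1(d_X(x,y))\leq \|\phi(x)-\phi(y)\|\leq \rho_2(d_X(x,y)).$$ Then there are a set $Z$ and a map $\psi$ of $X$ into a Banach space ultrapower of $\ell^2(E,Z)$ satisfying the same inequalities $$\rho_1(d_X(x,y))\leq \|\psi(x)-\psi(y)\|\leq \rho_2(d_X(x,y))\quad\text{for all }x,y\in X,$$ and such that the action of $G$ on $\psi(X)$, given by $g\cdot\psi(x)=\psi(gx)$, is well defined and extends to an action of $G$ by affine isometries on the affine span of $\psi(X)$.
   Context: A group is locally finite if every finitely generated subgroup of it is finite. For a normed space $E$ and a set $Z$, $\ell^2(E,Z)$ denotes the $\ell^2$-type direct sum of $|Z|$ copies of $E$, i.e. the space of all $f\colon Z\to E$ with $\|f\|=\left(\sum_{z\in Z}\|f(z)\|^2\right)^{1/2}<\infty$. Given an ultrafilter $\eta$ on a set $A$, the Banach space ultrapower of a normed space $V$ along $\eta$ is the quotient of the space of all bounded families $(y_\alpha)_{\alpha\in A}$ in $V$, equipped with the seminorm $\lim_{\alpha\to\eta}\|y_\alpha\|$, by the subspace of families of seminorm zero. *)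

(* Defs.v *)
From HB Require Import structures.
From mathcomp Require Import all_boot all_order all_algebra.
From mathcomp Require Import all_classical all_reals all_analysis.
From mathcomp Require Import ring.

Set Implicit Arguments.
Unset Strict Implicit.
Unset Printing Implicit Defensive.
Import Order.TTheory GRing.Theory Num.Theory.
Import numFieldNormedType.Exports.
Local Open Scope classical_set_scope.
Local Open Scope ring_scope.

Definition is_subgroup (G : groupType) (H : set G) : Prop :=
  [/\ H 1%g, forall g h, H g -> H h -> H (g * h)%g & forall g, H g -> H g^-1%g].

Definition finitely_generated (G : groupType) (H : set G) : Prop :=
  exists S : set G, finite_set S /\ H = smallest (@is_subgroup G) S.

Definition locally_finite (G : groupType) : Prop :=
  forall H : set G, is_subgroup H -> finitely_generated H -> finite_set H.

(* A left action of G on the subset D of T; only the values of [act] on D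
   matter. *)
Definition group_action_on (G : groupType) (T : Type) (D : set T)
    (act : G -> T -> T) : Prop :=
  [/\ forall g x, D x -> D (act g x),
      forall x, D x -> act 1%g x = x &
      forall g h x, D x -> act (g * h)%g x = act g (act h x)].

Definition isometric_action (R : realType) (G : groupType) (X : metricType R)
    (act : G -> X -> X) : Prop :=
  group_action_on setT act /\
  forall g x y, mdist (act g x) (act g y) = mdist x y.

Definition has_dense_orbit (R : realType) (G : groupType) (X : metricType R)
    (act : G -> X -> X) : Prop :=
  exists x0, dense (range (fun g => act g x0)).

Section affine.
Context (R : realType) (V : normedModType R).

(* The algebraic affine span: finite affine combinations, no closure taken. *)
Definition affine_span (S : set V) : set V :=
  [set v | exists (n : nat) (c : 'I_n -> R) (s : 'I_n -> V),
     [/\ forall i, S (s i), \sum_i c i = 1 & v = \sum_i c i *: s i]].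

Definition affine_on (D : set V) (f : V -> V) : Prop :=
  forall (n : nat) (c : 'I_n -> R) (s : 'I_n -> V),
    (forall i, D (s i)) -> \sum_i c i = 1 ->
    f (\sum_i c i *: s i) = \sum_i c i *: f (s i).

Definition isometry_on (D : set V) (f : V -> V) : Prop :=
  forall u v, D u -> D v -> `|f u - f v| = `|u - v|.

Definition affine_isometric_action_on (G : groupType) (D : set V)
    (act : G -> V -> V) : Prop :=
  group_action_on D act /\
  forall g, affine_on D (act g) /\ isometry_on D (act g).

End affine.

Section l2.
Context (R : realType) (E : normedModType R) (Z : choiceType).
Implicit Types f g : Z -> E.

Definition sqsum f : \bar R := (\esum_(z in [set: Z]) (`|f z| ^+ 2)%:E)%E.

Definition l2_pred : {pred Z -> E} := fun f => (sqsum f < +oo)%E.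

Let term_ge0 f z : (0 <= (`|f z| ^+ 2)%:E :> \bar R)%E.
Proof. by rewrite lee_fin exprn_ge0. Qed.

Lemma sqsum_ge0 f : (0 <= sqsum f)%E.
Proof. by apply: esum_ge0 => z _; exact: term_ge0. Qed.

Lemma sqsum_le f (M : \bar R) :
  (forall F : set Z, finite_set F ->
     (\sum_(z \in F) (`|f z| ^+ 2)%:E <= M)%E) -> (sqsum f <= M)%E.
Proof. by move=> h; apply: ge_ereal_sup => _ [F [finF _] <-]; exact: h. Qed.

Lemma sqsum_ge f (F : set Z) : finite_set F ->
  (\sum_(z \in F) (`|f z| ^+ 2)%:E <= sqsum f)%E.
Proof. by move=> finF; apply: esum_ge; exists F. Qed.

Lemma sqsumZ (k : R) f : (sqsum (k *: f) <= (k ^+ 2)%:E * sqsum f)%E.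
Proof.
apply: sqsum_le => F finF.
have -> : (\sum_(z \in F) (`|(k *: f) z| ^+ 2)%:E =
           (k ^+ 2)%:E * \sum_(z \in F) (`|f z| ^+ 2)%:E)%E.
  rewrite ge0_mule_fsumr//; apply: eq_fsbigr => z _.
  by rewrite -EFinM /= normrZ exprMn real_normK ?num_real.
by apply: lee_wpmul2l; [rewrite lee_fin sqr_ge0 | exact: sqsum_ge].
Qed.

Lemma sqsumD (s t : R) f g : 0 <= s -> 0 <= t ->
  (forall x y : R, 0 <= x -> 0 <= y -> (x + y) ^+ 2 <= s * x ^+ 2 + t * y ^+ 2) ->
  (sqsum (f + g)%R <= s%:E * sqsum f + t%:E * sqsum g)%E.
Proof.
move=> s0 t0 h; apply: sqsum_le => F finF.
apply: (@le_trans _ _ (\sum_(z \in F)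
    (s%:E * (`|f z| ^+ 2)%:E + t%:E * (`|g z| ^+ 2)%:E))%E).
  apply: lee_fsum => // z _; rewrite -!EFinM -EFinD lee_fin.
  apply: le_trans (h _ _ (normr_ge0 _) (normr_ge0 _)).
  by rewrite lerXn2r ?nnegrE ?addr_ge0// ler_normD.
rewrite fsbig_split//= -!ge0_mule_fsumr//.
by apply: leeD; apply: lee_wpmul2l; rewrite ?lee_fin//; exact: sqsum_ge.
Qed.

Lemma l2_submod_closed : submod_closed l2_pred.
Proof.
split.
  rewrite unfold_in /l2_pred /sqsum esum1// => z _.
  by rewrite normr0 expr0n.
move=> k f g fl2 gl2; rewrite !unfold_in /l2_pred in fl2 gl2 *.
have h (x y : R) : 0 <= x -> 0 <= y -> (x + y) ^+ 2 <= 2 * x ^+ 2 + 2 * y ^+ 2.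
  move=> _ _; rewrite -subr_ge0 (_ : _ - _ = (x - y) ^+ 2) ?sqr_ge0//.
  by ring.
apply: (le_lt_trans (sqsumD (k *: f) g _ _ h)) => //.
apply: lte_add_pinfty; last by rewrite lte_mul_pinfty// ?lee_fin.
rewrite lte_mul_pinfty// ?lee_fin//.
by apply: le_lt_trans (sqsumZ _ _) _; rewrite lte_mul_pinfty// ?lee_fin ?sqr_ge0.
Qed.

HB.instance Definition _ :=
  GRing.isSubmodClosed.Build R (Z -> E) l2_pred l2_submod_closed.

Record l2 : Type := L2 { l2_fun :> Z -> E; l2_funP : l2_fun \in l2_pred }.

HB.instance Definition _ := [isSub for l2_fun].
HB.instance Definition _ := [Choice of l2 by <:].
HB.instance Definition _ := [SubChoice_isSubLmodule of l2 by <:].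

Definition l2_norm (f : l2) : R := Num.sqrt (fine (sqsum f)).

Implicit Types u v : l2.

Lemma sqsum_fin u : sqsum u \is a fin_num.
Proof. by rewrite ge0_fin_numE ?sqsum_ge0//; exact: l2_funP. Qed.

Lemma l2_norm_ge0 u : 0 <= l2_norm u. Proof. exact: sqrtr_ge0. Qed.

Lemma l2_normK u : (l2_norm u ^+ 2)%:E = sqsum u.
Proof. by rewrite sqr_sqrtr ?fineK ?sqsum_fin// fine_ge0// sqsum_ge0. Qed.

Lemma l2_norm_le u (M : R) : 0 <= M ->
  (sqsum u <= (M ^+ 2)%:E)%E -> l2_norm u <= M.
Proof.
by move=> M0; rewrite -l2_normK lee_fin ler_pXn2r ?nnegrE ?l2_norm_ge0.
Qed.

Lemma l2_norm0_eq0 u : l2_norm u = 0 -> u = 0.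
Proof.
move=> f0; apply/val_inj/funext => z; apply/eqP; rewrite -normr_eq0.
rewrite -sqrf_eq0 eq_le exprn_ge0// andbT -lee_fin.
have := sqsum_ge u (finite_set1 z).
by rewrite fsbig_set1 -l2_normK f0 expr0n.
Qed.

Lemma ler_l2_normD u v : l2_norm (u + v) <= l2_norm u + l2_norm v.
Proof.
have [f0|fN0] := eqVneq (l2_norm u) 0.
  by rewrite (l2_norm0_eq0 f0) add0r lerDr l2_norm_ge0.
have [g0|gN0] := eqVneq (l2_norm v) 0.
  by rewrite (l2_norm0_eq0 g0) addr0 lerDl l2_norm_ge0.
have a0 : 0 < l2_norm u by rewrite lt_neqAle eq_sym fN0 l2_norm_ge0.
have b0 : 0 < l2_norm v by rewrite lt_neqAle eq_sym gN0 l2_norm_ge0.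
apply: l2_norm_le; first by rewrite addr_ge0 ?l2_norm_ge0.
set a := l2_norm u in a0 fN0 *; set b := l2_norm v in b0 gN0 *.
have h (x y : R) : 0 <= x -> 0 <= y ->
    (x + y) ^+ 2 <= (1 + b / a) * x ^+ 2 + (1 + a / b) * y ^+ 2.
  move=> _ _; rewrite -subr_ge0.
  rewrite (_ : _ - _ = (b * x - a * y) ^+ 2 / (a * b)).
    by rewrite divr_ge0 ?sqr_ge0// mulr_ge0// ltW.
  by field; rewrite fN0 gN0.
have ab0 : 0 <= 1 + b / a by rewrite addr_ge0// divr_ge0// ltW.
have ba0 : 0 <= 1 + a / b by rewrite addr_ge0// divr_ge0// ltW.
apply: (le_trans (sqsumD _ _ ab0 ba0 h)).
rewrite -!l2_normK -/a -/b -!EFinM -EFinD lee_fin le_eqVlt; apply/orP; left.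
by apply/eqP; field; rewrite fN0 gN0.
Qed.

Lemma l2_normZ (k : R) u : l2_norm (k *: u) = `|k| * l2_norm u.
Proof.
have le (c : R) v : l2_norm (c *: v) <= `|c| * l2_norm v.
  apply: l2_norm_le; first by rewrite mulr_ge0 ?l2_norm_ge0.
  apply: le_trans (sqsumZ _ _) _.
  by rewrite -l2_normK -EFinM exprMn real_normK ?num_real.
apply/eqP; rewrite eq_le le/=.
have [->|k0] := eqVneq k 0; first by rewrite normr0 mul0r l2_norm_ge0.
rewrite -ler_pdivlMl ?normr_gt0// -normfV.
by have := le k^-1 (k *: u); rewrite scalerA mulVf// scale1r.
Qed.

HB.instance Definition _ :=
  Lmodule_isNormed.Build R l2 ler_l2_normD l2_normZ l2_norm0_eq0.

Lemma normr_l2 u : `|u| = Num.sqrt (fine (sqsum u)). Proof. by []. Qed.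

End l2.

Arguments l2 {R} E Z.

Section bounded_families.
Context (R : realType) (V : normedModType R) (A : Type).

Definition bounded_fam_pred : {pred A -> V} :=
  fun y => `[< exists M : R, forall a, `|y a| <= M >].

Lemma bounded_fam_submod_closed : submod_closed bounded_fam_pred.
Proof.
split; first by apply/asboolP; exists 0 => a; rewrite normr0.
move=> k x y /asboolP[M xM] /asboolP[N yN]; apply/asboolP.
exists (`|k| * M + N) => a; apply: le_trans (ler_normD _ _) _.
by rewrite lerD// normrZ ler_wpM2l.
Qed.

HB.instance Definition _ := GRing.isSubmodClosed.Build R (A -> V)
  bounded_fam_pred bounded_fam_submod_closed.

Record bounded_fam : Type := BoundedFam {
  fam_fun :> A -> V; fam_funP : fam_fun \in bounded_fam_pred }.

HB.instance Definition _ := [isSub for fam_fun].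
HB.instance Definition _ := [Choice of bounded_fam by <:].
HB.instance Definition _ := [SubChoice_isSubLmodule of bounded_fam by <:].

End bounded_families.

Section ultrapower.
Context (R : realType) (V : normedModType R) (A : Type).
Context (eta : set_system A) {eta_ultra : UltraFilter eta}.
Implicit Types x y : bounded_fam V A.

Definition ultra_seminorm y : R := lim (`|y a| @[a --> eta]).

Lemma ultra_seminorm_cvg y : `|y a| @[a --> eta] --> ultra_seminorm y.
Proof.
have /asboolP[M yM] := fam_funP y.
have := @segment_compact R 0 M.
rewrite compact_ultra => /(_ (fmap (fun a => `|y a|) eta)) h.
have um : UltraFilter (fmap (fun a => `|y a|) eta).
  split; first exact: fmap_proper_filter.
  move=> F FF le; apply/seteqP; split => // B FB.
  have [//|etaC] := in_ultra_setVsetC ((fun a => `|y a|) @^-1` B) eta_ultra.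
  have FC : F (~` B) by apply: le.
  by case: (filter_not_empty F); rewrite -(setICr B); exact: filterI.
have y0M : fmap (fun a => `|y a|) eta `[0, M]%classic.
  by apply: (@filterE _ eta) => a; rewrite /= in_itv/= normr_ge0 yM.
have [l [_ yl]] := h um y0M.
exact: cvgP yl.
Qed.

Arguments ultra_seminorm_cvg y : clear implicits.

Lemma ultra_seminorm_unique y (l : R) :
  `|y a| @[a --> eta] --> l -> ultra_seminorm y = l.
Proof. by move=> yl; apply/cvg_lim. Qed.

Lemma ultra_seminorm_ge0 y : 0 <= ultra_seminorm y.
Proof.
apply: limr_ge.
  exact: cvgP (ultra_seminorm_cvg y).
by apply: nearW => a; exact: normr_ge0.
Qed.

Lemma ler_ultra_seminormD x y :
  ultra_seminorm (x + y) <= ultra_seminorm x + ultra_seminorm y.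
Proof.
rewrite -subr_ge0; set l := _ - _.
have dl : `|x a| + `|y a| - `|(x + y) a| @[a --> eta] --> l.
  by apply: cvgB; [apply: cvgD|]; exact: ultra_seminorm_cvg.
rewrite -(cvg_lim (@Rhausdorff R) dl); apply: limr_ge; first exact: cvgP dl.
by apply: nearW => a; rewrite subr_ge0 ler_normD.
Qed.

Lemma ultra_seminormZ (k : R) y :
  ultra_seminorm (k *: y) = `|k| * ultra_seminorm y.
Proof.
apply: ultra_seminorm_unique.
under eq_cvg do rewrite normrZ.
by apply: cvgM; [exact: cvg_cst | exact: ultra_seminorm_cvg].
Qed.

Definition null_fam : {pred bounded_fam V A} := fun y => ultra_seminorm y == 0.

Lemma null_fam_zmod_closed : zmod_closed null_fam.
Proof.
split; first by rewrite unfold_in /null_fam -(scale0r 0) ultra_seminormZ normr0 mul0r.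
move=> x y /eqP x0 /eqP y0; apply/eqP/le_anti; rewrite ultra_seminorm_ge0 andbT.
apply: le_trans (ler_ultra_seminormD _ _) _.
by rewrite -scaleN1r ultra_seminormZ x0 y0 mulr0 addr0.
Qed.

HB.instance Definition _ := GRing.isZmodClosed.Build (bounded_fam V A)
  null_fam null_fam_zmod_closed.

(* As in the definition of the ultrapower of a normed space, nothing is
   completed: V need not be complete and eta may be principal. *)
Definition ultrapower : Type := Quotient.quot null_fam.

HB.instance Definition _ := GRing.Zmodule.on ultrapower.
HB.instance Definition _ := ZmodQuotient.on ultrapower.

Local Open Scope quotient_scope.
Implicit Types p q : ultrapower.

Definition ultra_class (y : bounded_fam V A) : ultrapower := \pi_ultrapower y.

Definition ultra_scale (k : R) p : ultrapower := ultra_class (k *: repr p).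

Definition ultra_norm p : R := ultra_seminorm (repr p).

Lemma ultra_classP x y :
  ultra_class x = ultra_class y <-> ultra_seminorm (x - y) = 0.
Proof.
rewrite /ultra_class; split => [/eqP|/eqP xy]; last apply/eqP.
  by rewrite -Quotient.idealrBE => /eqP.
by rewrite -Quotient.idealrBE.
Qed.

Lemma ultra_class_repr p : ultra_class (repr p) = p.
Proof. exact: reprK. Qed.

Lemma ultra_classD x y : ultra_class (x + y) = ultra_class x + ultra_class y.
Proof. by rewrite /ultra_class -pi_addr. Qed.

Lemma ultra_norm_class y : ultra_norm (ultra_class y) = ultra_seminorm y.
Proof.
have /ultra_classP : ultra_class (repr (ultra_class y)) = ultra_class y.
  exact: ultra_class_repr.
rewrite /ultra_norm; set x := repr _ => xy0.
have yx0 : ultra_seminorm (y - x) = 0.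
  by rewrite -opprB -scaleN1r ultra_seminormZ xy0 mulr0.
apply/eqP; rewrite eq_le; apply/andP; split.
  by have := ler_ultra_seminormD (x - y) y; rewrite subrK xy0 add0r.
by have := ler_ultra_seminormD (y - x) x; rewrite subrK yx0 add0r.
Qed.

Lemma ultra_scale_class k y : ultra_scale k (ultra_class y) = ultra_class (k *: y).
Proof.
apply/ultra_classP; rewrite -scalerBr ultra_seminormZ.
by have /ultra_classP -> := ultra_class_repr (ultra_class y); rewrite mulr0.
Qed.

Lemma ultra_scaleA (a b : R) p :
  ultra_scale a (ultra_scale b p) = ultra_scale (a * b) p.
Proof. by rewrite -(ultra_class_repr p) !ultra_scale_class scalerA. Qed.

Lemma ultra_scale1 : left_id 1 ultra_scale.
Proof.
by move=> p; rewrite -(ultra_class_repr p) ultra_scale_class scale1r.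
Qed.

Lemma ultra_scaleDr : right_distributive ultra_scale +%R.
Proof.
move=> k p q; rewrite -(ultra_class_repr p) -(ultra_class_repr q).
by rewrite -ultra_classD !ultra_scale_class scalerDr ultra_classD.
Qed.

Lemma ultra_scaleDl p : {morph ultra_scale^~ p : a b / a + b}.
Proof.
move=> a b; rewrite -(ultra_class_repr p) !ultra_scale_class.
by rewrite scalerDl ultra_classD.
Qed.

HB.instance Definition _ := GRing.Zmodule_isLmodule.Build R ultrapower
  ultra_scaleA ultra_scale1 ultra_scaleDr ultra_scaleDl.

Lemma ultra_classZ k y : ultra_class (k *: y) = k *: ultra_class y.
Proof. by rewrite -ultra_scale_class. Qed.

Lemma ler_ultra_normD p q : ultra_norm (p + q) <= ultra_norm p + ultra_norm q.
Proof.
rewrite -(ultra_class_repr p) -(ultra_class_repr q) -ultra_classD.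
by rewrite !ultra_norm_class ler_ultra_seminormD.
Qed.

Lemma ultra_normZ k p : ultra_norm (k *: p) = `|k| * ultra_norm p.
Proof.
rewrite -(ultra_class_repr p) -ultra_classZ !ultra_norm_class.
exact: ultra_seminormZ.
Qed.

Lemma ultra_norm0_eq0 p : ultra_norm p = 0 -> p = 0.
Proof.
rewrite -(ultra_class_repr p) ultra_norm_class => p0.
have <- : ultra_class 0 = 0 by rewrite -(scale0r 0) ultra_classZ scale0r.
by apply/ultra_classP; rewrite subr0.
Qed.

HB.instance Definition _ := Lmodule_isNormed.Build R ultrapower
  ler_ultra_normD ultra_normZ ultra_norm0_eq0.

Lemma normr_ultra_class y : `|ultra_class y| = ultra_seminorm y.
Proof. exact: ultra_norm_class. Qed.

End ultrapower.

Arguments ultrapower {R} V {A} eta {eta_ultra}.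

(* Main.v *)
Require Import Defs.
From HB Require Import structures.
From mathcomp Require Import all_boot all_order all_algebra.
From mathcomp Require Import all_classical all_reals all_analysis.
From mathcomp Require Import finmap.

Set Implicit Arguments.
Unset Strict Implicit.
Unset Printing Implicit Defensive.
Import Order.TTheory GRing.Theory Num.Theory.
Import numFieldNormedType.Exports.
Local Open Scope classical_set_scope.
Local Open Scope ring_scope.

(** Average [phi] over larger and larger finite subgroups of [G], keeping all
the translates side by side instead of adding them up.  For a finite subgroup
[H] put
  [psi_H x = #|H|^(-1/2) * (phi (z^-1 x))_(z in H)],
an element of [l2 E G].  Then [`|psi_H x - psi_H y|^2] is the mean over
[z in H] of [`|phi (z^-1 x) - phi (z^-1 y)|^2], and [z^-1] does not change the
distance of [x] and [y], so the bounds [rho1], [rho2] survive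
([norm_avg_ge], [norm_avg_le]).  If [g] is in [H], replacing every [x_i] by
[g x_i] in a combination [sum_i c_i psi_H (x_i)] only permutes the coordinates
by [z |-> g^-1 z], hence preserves its norm ([norm_avg_comp]).

Since [G] is locally finite, any finitely many elements lie in a finite
subgroup, so some ultrafilter contains, for every [g], the set of finite
subgroups through [g] ([finite_subgroup_ultrafilter]).  The ultralimit [psi] of
the maps [psi_H - psi_H x0] keeps the bounds and satisfies
  [`|sum_i c_i psi (g x_i)| = `|sum_i c_i psi (x_i)|] when [sum_i c_i = 0],
now for all [g] in [G].  The base point [x0] is subtracted to make the
families bounded: [`|psi_H x - psi_H x0| <= rho2 (d (x, x0))] for all [H],
while [`|psi_H x|] may be unbounded; combinations of total weight zero do not
see it.

This identity is all that is needed to extend the action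
([affine_extension]): applied to the difference of two affine combinations, it
says that [sum_i c_i psi (x_i) |-> sum_i c_i psi (g x_i)] is well defined and
isometric on the affine span of the range of [psi]. *)

(** * Extending an action from a subset to its affine span *)

Section affine_extension.
Context (R : realType) (V : normedModType R).

Lemma affine_span_fin (S : set V) (I : finType) (c : I -> R) (s : I -> V) :
  (forall i, S (s i)) -> \sum_i c i = 1 -> affine_span S (\sum_i c i *: s i).
Proof.
move=> Ss c1; exists #|I|, (c \o enum_val), (s \o enum_val).
have ev_bij := onW_bij xpredT (enum_val_bij I).
split=> [i /=||]; first exact: Ss.
  by rewrite -c1 [RHS](reindex _ ev_bij).
by rewrite (reindex _ ev_bij).
Qed.

Context (G : groupType) (X : Type) (act : G -> X -> X) (psi : X -> V).

Lemma affine_span_range v : affine_span (range psi) v ->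
  exists (n : nat) (c : 'I_n -> R) (x : 'I_n -> X),
    \sum_i c i = 1 /\ v = \sum_i c i *: psi (x i).
Proof.
move=> [n [c [s [Ss c1 ->]]]].
have /choice[x xs] : forall i, exists x, psi x = s i.
  by move=> i; have [x _ <-] := Ss i; exists x.
by exists n, c, x; split=> //; apply: eq_bigr => i _; rewrite xs.
Qed.

Hypothesis act_group : group_action_on setT act.
Hypothesis psi_isom : forall (g : G) (I : finType) (c : I -> R) (x : I -> X),
  \sum_i c i = 0 ->
  `|\sum_i c i *: psi (act g (x i))| = `|\sum_i c i *: psi (x i)|.

(** The difference of two affine combinations is a single combination of total
weight zero, indexed by the disjoint union of the two index types. *)
Lemma affine_comb_isom (g : G) (I J : finType) (c : I -> R) (x : I -> X)
    (d : J -> R) (y : J -> X) : \sum_i c i = 1 -> \sum_j d j = 1 ->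
  `|\sum_i c i *: psi (act g (x i)) - \sum_j d j *: psi (act g (y j))| =
  `|\sum_i c i *: psi (x i) - \sum_j d j *: psi (y j)|.
Proof.
move=> c1 d1.
pose e (k : I + J) := match k with inl i => c i | inr j => - d j end.
pose w (k : I + J) := match k with inl i => x i | inr j => y j end.
have subE (f : X -> V) : \sum_i c i *: f (x i) - \sum_j d j *: f (y j) =
    \sum_k e k *: f (w k).
  by rewrite big_sumType/= -sumrN; under [X in _ + X]eq_bigr do rewrite -scaleNr.
rewrite (subE psi) (subE (psi \o act g)) psi_isom//.
by rewrite big_sumType/= c1 sumrN d1 subrr.
Qed.

(** The affine action of [g] has to send [sum_i c_i psi (x_i)] to
[sum_i c_i psi (g x_i)].  By [affine_comb_isom] the result depends only on the
point and not on how it is written as a combination, and this freedom gives the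
remaining properties: each amounts to writing one point in two ways. *)
Lemma affine_extension :
  exists aff_act : G -> V -> V,
    affine_isometric_action_on (affine_span (range psi)) aff_act /\
    forall g x, aff_act g (psi x) = psi (act g x).
Proof.
have [_ act1 actM] := act_group.
have /choice[f fE] : forall gv : G * V, exists w, forall (I : finType)
    (c : I -> R) (x : I -> X), \sum_i c i = 1 -> gv.2 = \sum_i c i *: psi (x i) ->
    w = \sum_i c i *: psi (act gv.1 (x i)).
  case=> g v /=.
  have [/affine_span_range[n [d [y [d1 vE]]]]|vN] := pselect (affine_span (range psi) v).
    exists (\sum_i d i *: psi (act g (y i))) => I c x c1 vE'.
    apply/eqP; rewrite -subr_eq0 -normr_eq0 affine_comb_isom// -vE -vE' subrr.
    by rewrite normr0.
  (* outside the affine span, an arbitrary value *)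
  exists 0 => I c x c1 vE; case: vN; rewrite vE.
  by apply: affine_span_fin => // i; exists (x i).
pose aff g v := f (g, v).
have affE g (I : finType) (c : I -> R) (x : I -> X) : \sum_i c i = 1 ->
    aff g (\sum_i c i *: psi (x i)) = \sum_i c i *: psi (act g (x i)).
  by move=> c1; exact: (fE (g, _)).
exists aff; split; last first.
  move=> g x; have := @affE g 'I_1 (fun=> 1) (fun=> x).
  by rewrite !big_ord1 !scale1r; apply.
split.
  split.
  - move=> g v /affine_span_range[n [c [x [c1 ->]]]]; rewrite affE//.
    by apply: affine_span_fin => // i; exists (act g (x i)).
  - move=> v /affine_span_range[n [c [x [c1 ->]]]]; rewrite affE//.
    by apply: eq_bigr => i _; rewrite act1.
  - move=> g h v /affine_span_range[n [c [x [c1 ->]]]]; rewrite !affE//.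
    by apply: eq_bigr => i _; rewrite actM.
move=> g; split; last first.
  move=> u v /affine_span_range[n [c [x [c1 ->]]]].
  move=> /affine_span_range[m [d [y [d1 ->]]]].
  by rewrite !affE// affine_comb_isom.
move=> n c s sS c1.
(* An affine combination of affine combinations is flattened to one over the
   pairs [(i, j)], with weights [c i * d i j]. *)
have [m m_rep] := choice (fun i => affine_span_range (sS i)).
pose d i := projT1 (cid (m_rep i)).
have d_rep i : exists x : 'I_(m i) -> X,
    \sum_j d i j = 1 /\ s i = \sum_j d i j *: psi (x j).
  exact: projT2 (cid (m_rep i)).
pose y i := projT1 (cid (d_rep i)).
have ysd i : \sum_j d i j = 1 /\ s i = \sum_j d i j *: psi (y i j).
  exact: projT2 (cid (d_rep i)).
pose J := {i : 'I_n & 'I_(m i)}.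
pose e (k : J) := c (tag k) * d (tag k) (tagged k).
pose w (k : J) := y (tag k) (tagged k).
have combE (h : X -> V) : \sum_i c i *: (\sum_j d i j *: h (y i j)) =
    \sum_k e k *: h (w k).
  under eq_bigr do rewrite scaler_sumr; rewrite sig_big_dep/=.
  by apply: eq_bigr => k _; rewrite scalerA.
have e1 : \sum_k e k = 1.
  transitivity (\sum_i \sum_j c i * d i j); first by rewrite sig_big_dep.
  rewrite -c1.
  by apply: eq_bigr => i _; rewrite -mulr_sumr (ysd i).1 mulr1.
under eq_bigr do rewrite (ysd _).2.
rewrite combE affE// -(combE (psi \o act g)).
by apply: eq_bigr => i _; rewrite (ysd i).2 affE// (ysd i).1.
Qed.

End affine_extension.

(** * Normalised restriction to a finite set *)

Section l2_average.
Context (R : realType) (E : normedModType R) (Z : choiceType).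
Implicit Types (F : {fset Z}) (u v : Z -> E).

Lemma sqsum_fset F u : (forall z, z \notin F -> u z = 0) ->
  sqsum u = (\sum_(z <- F) `|u z| ^+ 2)%:E.
Proof.
move=> u0; rewrite -sumEFin.
transitivity (\esum_(z in [set` F]) (`|u z| ^+ 2)%:E)%E; last first.
  by rewrite esum_fset// fsbig_finite//= set_fsetK.
rewrite [RHS]esum_mkcond; apply: eq_esum => z _; case: ifPn => //.
by rewrite mem_setE => /u0 ->; rewrite normr0 expr0n.
Qed.

(** The factor [#|F|^(-1/2)] makes the squared [l2] norm the mean over [F] of
the squared norms of the values; it is [0] for the empty [F]. *)
Definition avg_fun F u : Z -> E := fun z =>
  if z \in F then (Num.sqrt #|` F|%:R)^-1 *: u z else 0.

Lemma sqsum_avg_fun F u :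
  sqsum (avg_fun F u) = (#|` F|%:R^-1 * \sum_(z <- F) `|u z| ^+ 2)%:E.
Proof.
rewrite (@sqsum_fset F) /avg_fun; last by move=> z /negbTE ->.
congr EFin; rewrite mulr_sumr; apply: eq_big_seq => z ->.
rewrite normrZ exprMn normfV exprVn ger0_norm ?sqrtr_ge0// sqr_sqrtr//.
Qed.

Lemma avg_funP F u : avg_fun F u \in l2_pred (E := E) (Z := Z).
Proof. by rewrite unfold_in /l2_pred sqsum_avg_fun ltry. Qed.

Definition avg F u : l2 E Z := L2 (avg_funP F u).

Lemma avg_is_linear F : linear (avg F).
Proof.
move=> k u v; apply/val_inj/funext => z.
rewrite -[LHS]/(avg_fun F (k *: u + v) z).
rewrite -[RHS]/(k *: avg_fun F u z + avg_fun F v z) /avg_fun.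
case: ifP => _; last by rewrite scaler0 addr0.
by rewrite -[(k *: u + v) z]/(k *: u z + v z) scalerDr !scalerA mulrC.
Qed.

HB.instance Definition _ F :=
  GRing.isLinear.Build R (Z -> E) (l2 E Z) _ (avg F) (avg_is_linear F).

Lemma norm_avg F u :
  `|avg F u| = Num.sqrt (#|` F|%:R^-1 * \sum_(z <- F) `|u z| ^+ 2).
Proof. by rewrite normr_l2 sqsum_avg_fun. Qed.

Lemma norm_avg_le F u (b : R) : 0 <= b ->
  (forall z, z \in F -> `|u z| <= b) -> `|avg F u| <= b.
Proof.
move=> b0 ub; rewrite norm_avg -[leRHS]ger0_norm// -sqrtr_sqr ler_sqrt ?sqr_ge0//.
apply: (@le_trans _ _ (#|` F|%:R^-1 * \sum_(z <- F) b ^+ 2)).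
  rewrite ler_wpM2l ?invr_ge0// big_seq [leRHS]big_seq.
  apply: ler_sum => z zF.
  by rewrite ler_sqr ?nnegrE ?ub.
rewrite big_const_seq count_predT iter_addr_0 -[X in _ * X]mulr_natl mulrA.
have [->|F0] := eqVneq #|` F| 0%N; first by rewrite mulr0 mul0r sqr_ge0.
by rewrite mulVf ?pnatr_eq0// mul1r.
Qed.

Lemma norm_avg_ge F u (b : R) : F != fset0 -> 0 <= b ->
  (forall z, z \in F -> b <= `|u z|) -> b <= `|avg F u|.
Proof.
move=> F0 b0 ub; rewrite norm_avg -[leLHS]ger0_norm// -sqrtr_sqr ler_wsqrtr//.
apply: (@le_trans _ _ (#|` F|%:R^-1 * \sum_(z <- F) b ^+ 2)); last first.
  rewrite ler_wpM2l ?invr_ge0// big_seq [leRHS]big_seq.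
  apply: ler_sum => z zF.
  by rewrite ler_sqr ?nnegrE ?ub.
rewrite big_const_seq count_predT iter_addr_0 -[X in _ * X]mulr_natl mulrA.
by rewrite mulVf ?pnatr_eq0 ?cardfs_eq0// mul1r.
Qed.

(** An injection of the finite set [F] into itself permutes [F], so it only
reorders the terms of the mean. *)
Lemma norm_avg_comp F u (s : Z -> Z) : injective s ->
  (forall z, z \in F -> s z \in F) -> `|avg F (u \o s)| = `|avg F u|.
Proof.
move=> sinj sF; rewrite !norm_avg; congr (Num.sqrt (_ * _)).
rewrite -(big_map s xpredT (fun z => `|u z| ^+ 2)); apply: perm_big.
have us : uniq (map s F) by rewrite map_inj_uniq ?fset_uniq.
have [|_ sFE] := uniq_min_size us _ (eq_leq (esym (size_map s F))).
  by move=> _ /mapP[z zF ->]; exact: sF.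
by apply: uniq_perm => //; exact: fset_uniq.
Qed.

End l2_average.

(** * Linear combinations in an ultrapower *)

Section ultrapower_sums.
Context (R : realType) (V : normedModType R) (A : Type).
Context (eta : set_system A) {eta_ultra : UltraFilter eta}.

Lemma ultra_class_sum (I : finType) (c : I -> R) (y : I -> bounded_fam V A) :
  \sum_i c i *: ultra_class (eta := eta) (y i) =
  ultra_class (\sum_i c i *: y i).
Proof.
have class0 : @ultra_class R V A eta _ 0 = 0.
  by rewrite -(scale0r 0) ultra_classZ scale0r.
rewrite (big_morph _ (@ultra_classD R V A eta _) class0).
by apply: eq_bigr => i _; rewrite ultra_classZ.
Qed.

Lemma fam_fun_sum (I : finType) (c : I -> R) (y : I -> bounded_fam V A) a :
  (\sum_i c i *: y i) a = \sum_i c i *: y i a.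
Proof.
by elim/big_ind2: _ => [|p q p' q' <- <-|].
Qed.

Lemma normr_ultra_class_eq (y y' : bounded_fam V A) :
  (\forall a \near eta, `|y a| = `|y' a|) ->
  `|ultra_class (eta := eta) y| = `|ultra_class (eta := eta) y'|.
Proof.
move=> yy'; rewrite !normr_ultra_class; apply: ultra_seminorm_unique.
apply: cvg_trans (ultra_seminorm_cvg (y := y')); apply: near_eq_cvg.
by apply: filterS yy' => a /esym.
Qed.

Lemma normr_ultra_class_itv (y : bounded_fam V A) (l u : R) :
  (\forall a \near eta, l <= `|y a| <= u) ->
  l <= `|ultra_class (eta := eta) y| <= u.
Proof.
move=> yb; rewrite normr_ultra_class; 
have yc := cvgP _ (@ultra_seminorm_cvg _ _ _ _ eta_ultra y).
by apply/andP; split; [apply: limr_ge|apply: limr_le] => //;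
  apply: filterS yb => a /andP[].
Qed.

End ultrapower_sums.

(** * Exhausting a locally finite group by its finite subgroups *)

Section finite_subgroups.
Context (G : groupType).

Lemma smallest_subgroup (S : set G) : is_subgroup (smallest (@is_subgroup G) S).
Proof.
split=> [H [[]]//|g h gS hS H HS|g gS H HS]; have [[H1 HM HV] _] := HS.
  by apply: HM; [exact: gS | exact: hS].
by apply: HV; exact: gS.
Qed.

(** The index set consists of all subsets of [G]; the ultrafilter refines the
filter generated by the sets of finite subgroups containing a given finite set
[S].  Local finiteness makes this filter proper: the subgroup generated by [S]
is finite. *)
Lemma finite_subgroup_ultrafilter : locally_finite G ->
  exists2 eta : set_system (set G), UltraFilter eta &
    forall g, \forall H \near eta, [/\ is_subgroup H, finite_set H & H g].
Proof.
move=> lfG.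
pose eta0 : set_system (set G) := [set P | exists2 S : set G, finite_set S &
  forall H, is_subgroup H -> finite_set H -> S `<=` H -> P H].
have eta0_proper : ProperFilter eta0.
  split.
    case=> S finS /(_ (smallest (@is_subgroup G) S)); apply.
    - exact: smallest_subgroup.
    - by apply: lfG; [exact: smallest_subgroup | exists S].
    - exact: sub_gen_smallest.
  split=> [|P Q [S finS SP] [T finT TQ]|P Q PQ [S finS SP]].
  - by exists set0.
  - exists (S `|` T); first by rewrite finite_setU.
    move=> H Hsub finH; rewrite subUset => -[SH TH]; split; [exact: SP | exact: TQ].
  - by exists S => // H *; apply/PQ/SP.
have [eta [eta_ultra eta0_eta]] := ultraFilterLemma eta0_proper.
exists eta => // g; apply: eta0_eta; exists [set g] => // H Hsub finH gH.
by split=> //; exact: gH.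
Qed.

End finite_subgroups.

Theorem theorem4p2 (R : realType) (G : groupType) (X : metricType R)
    (act : G -> X -> X) (E : normedModType R) (phi : X -> E)
    (rho1 rho2 : R -> R) :
  locally_finite G ->
  isometric_action act ->
  has_dense_orbit act ->
  (forall t : R, 0 <= t -> 0 <= rho1 t) ->
  (forall t : R, 0 <= t -> 0 <= rho2 t) ->
  (forall x y, rho1 (mdist x y) <= `|phi x - phi y| <= rho2 (mdist x y)) ->
  exists (Z : choiceType) (A : Type) (eta : set_system A)
    (eta_ultra : UltraFilter eta) (psi : X -> ultrapower (l2 E Z) eta),
    [/\ forall x y, rho1 (mdist x y) <= `|psi x - psi y| <= rho2 (mdist x y),
        forall g x y, psi x = psi y -> psi (act g x) = psi (act g y) &
        exists aff_act : G -> ultrapower (l2 E Z) eta -> ultrapower (l2 E Z) eta,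
          affine_isometric_action_on (affine_span (range psi)) aff_act /\
          forall g x, aff_act g (psi x) = psi (act g x)].
Proof.
move=> lfG [act_group act_isom] [x0 _] rho1_ge0 rho2_ge0 phi_rho.
have [_ _ actM] := act_group.
have [eta eta_ultra eta_sub] := finite_subgroup_ultrafilter lfG.
pose orb x : G -> E := fun z => phi (act z^-1%g x).
pose fam_of x (H : set G) := avg (fset_set H) (orb x - orb x0).
have orb_rho x y z : rho1 (mdist x y) <= `|(orb x - orb y) z| <= rho2 (mdist x y).
  by rewrite -(act_isom z^-1%g x y); exact: phi_rho.
have fam_bounded x : fam_of x \in bounded_fam_pred (V := l2 E G) (A := set G).
  apply/asboolP; exists (rho2 (mdist x x0)) => H; apply: norm_avg_le => [|z _].
    by rewrite rho2_ge0 ?mdist_ge0.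
  by have /andP[] := orb_rho x x0 z.
pose fam x := BoundedFam (fam_bounded x).
pose psi x := @ultra_class _ _ _ eta eta_ultra (fam x).
(* The base point drops out of combinations of total weight zero. *)
have famD (I : finType) (c : I -> R) (x : I -> X) H : \sum_i c i = 0 ->
    (\sum_i c i *: fam (x i)) H = avg (fset_set H) (\sum_i c i *: orb (x i)).
  move=> c0; rewrite fam_fun_sum/= /fam_of.
  under eq_bigr do rewrite -linearZ/= scalerBr.
  by rewrite -linear_sum/= sumrB -scaler_suml c0 scale0r subr0.
have psi_isom (g : G) (I : finType) (c : I -> R) (x : I -> X) :
    \sum_i c i = 0 ->
    `|\sum_i c i *: psi (act g (x i))| = `|\sum_i c i *: psi (x i)|.
  move=> c0; rewrite !ultra_class_sum; apply: normr_ultra_class_eq.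
  apply: filterS (eta_sub g) => H [[_ HM HV] finH Hg]; rewrite !famD//.
  rewrite -[RHS](@norm_avg_comp _ _ _ _ _ (fun z => (g^-1 * z)%g)).
  (* [z^-1 (g x) = (g^-1 z)^-1 x]: acting by [g] translates the coordinates *)
  - congr `|avg _ _|; apply/funext => z /=; rewrite !fct_sumE.
    apply: eq_bigr => i _.
    rewrite -[LHS]/(c i *: orb _ z) -[RHS]/(c i *: orb _ (g^-1 * z)%g) /orb.
    by rewrite invgM invgK actM.
  - exact: mulgI.
  - by move=> z; rewrite !in_fset_set// !in_setE => Hz; apply: HM => //; exact: HV.
have [aff [aff_action affE]] := affine_extension act_group psi_isom.
exists G, (set G), eta, eta_ultra, psi; split.
- move=> x y.
  have -> : psi x - psi y = ultra_class (fam x - fam y).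
    by rewrite ultra_classD -[- fam y]scaleN1r ultra_classZ scaleN1r.
  apply: normr_ultra_class_itv; apply: filterS (eta_sub 1%g) => H [_ finH H1].
  have -> : (fam x - fam y) H = avg (fset_set H) (orb x - orb y).
    rewrite -[LHS]/(fam_of x H - fam_of y H) -linearB/=.
    by rewrite opprB addrA subrK.
  apply/andP; split.
    apply: norm_avg_ge => [||z _]; last by have /andP[] := orb_rho x y z.
      by apply/fset0Pn; exists 1%g; rewrite in_fset_set ?in_setE.
    by rewrite rho1_ge0 ?mdist_ge0.
  apply: norm_avg_le => [|z _]; first by rewrite rho2_ge0 ?mdist_ge0.
  by have /andP[] := orb_rho x y z.
- by move=> g x y xy; rewrite -!affE xy.
- by exists aff.
Qed.
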